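(* Standard étale schemes are étale.
   Context: We work in homotopy type theory with univalent universes and propositional truncation (neither excluded middle nor the axiom of choice is assumed). ''Merely'', ''there exists'' and disjunction refer to propositional truncation; a map is surjective if its fibers are merely inhabited. Fix a commutative ring $R$. A finitely presented $R$-algebra is one merely of the form $R[X_1,\dots,X_n]/(P_1,\dots,P_l)$; for such $A$, $\mathrm{Spec}(A)$ is the type of $R$-algebra homomorphisms $A\to R$, and for $a:A$, $x:\mathrm{Spec}(A)$ one writes $a(x)=x(a)$. A Zariski-cover of $\mathrm{Spec}(A)$ is a finite family of subtypes $U_i=\{x\mid f_i(x)\text{ invertible}\}$ with $f_1,\dots,f_n:A$ generating the unit ideal. Axioms: (Locality) $R$ is local: $1\neq 0$, and if $x+y$ is invertible then $x$ or $y$ is invertible. (Duality) For every finitely presented $R$-algebra $A$ the map $A\to(\mathrm{Spec}(A)\to R)$, $a\mapsto(\varphi\mapsto\varphi(a))$ is an isomorphism of $R$-algebras. (Zariski-local choice) For every finitely presented $R$-algebra $A$ and family $B$ of merely inhabited types over $\mathrm{Spec}(A)$, there merely exist a Zariski-cover $U_1,\dots,U_n$ of $\mathrm{Spec}(A)$ and dependent functions $s_i:(x:U_i)\to B(x)$. A proposition is open if it is merely of the form $r_1\neq 0\vee\dots\vee r_n\neq 0$ with $r_i:R$, and closed if merely of the form $r_1=0\wedge\dots\wedge r_n=0$. A subtype $U$ of a type $X$ is open if $x\in U$ is an open proposition for all $x:X$. An affine scheme is a type merely of the form $\mathrm{Spec}(A)$ with $A$ a finitely presented $R$-algebra; a scheme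 is a type that merely has a finite cover by open subtypes that are affine schemes. A closed proposition is dense (closed dense) if it is merely of the form $r_1=0\wedge\dots\wedge r_n=0$ with all $r_i$ nilpotent. A type $X$ is formally étale if for every closed dense proposition $P$ the map $X\to X^P$ sending $x$ to the constant map is an equivalence. An étale scheme is a scheme which is formally étale as a type. A standard étale scheme is an affine scheme (merely) of the form $\mathrm{Spec}(R[X_1,\dots,X_n]/(P_1,\dots,P_n))$ where the determinant of $\left(\frac{\partial P_i}{\partial X_j}\right)_{1\leq i,j\leq n}$ is invertible in $R[X_1,\dots,X_n]/(P_1,\dots,P_n)$. *)

(* Defs.v *)
(** Synthetic algebraic geometry, in the set-level fragment of type theory.

    [Prop] is the type of propositions: [exists], [\/] and [inhabited] are
    propositional truncations, and function and propositional extensionality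
    are the Stdlib axioms.  Propositional extensionality makes equality
    proof-irrelevant, so every type is a set, and it is all that univalence
    says about propositions.  Neither excluded middle nor choice is used.

    The rings of MathComp carry a decidable equality, which contradicts
    [duality] below (for a local ring the indicator function of [0] is not a
    polynomial), so commutative rings are built on Stdlib's [ring_theory].
    MathComp supplies finite index types, permutations and iterated
    operations, which need no equality on the carrier. *)
From Stdlib Require Import FunctionalExtensionality PropExtensionality Setoid.
From Stdlib Require Import Ring_theory Ring.
From mathcomp Require Import all_boot fingroup perm.

Set Implicit Arguments.
Unset Strict Implicit.
Unset Printing Implicit Defensive.
#[local] Obligation Tactic := try by [].

(** The elimination rule of the propositional truncation: not derivable for
    [inhabited], whose eliminator only reaches [Prop]. *)
Definition prop_trunc_elim : Type :=
  forall A B : Type, (forall x y : B, x = y) -> (A -> B) -> inhabited A -> B.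

(** Types being sets, a two-sided inverse is the same as an equivalence, and it
    is unique, so that its truncated existence loses nothing. *)
Definition is_equiv (X Y : Type) (f : X -> Y) : Prop :=
  exists g : Y -> X, (forall x, g (f x) = x) /\ (forall y, f (g y) = y).

Definition type_equiv (X Y : Type) : Prop := exists f : X -> Y, is_equiv f.

Lemma prop_irrel (P : Prop) (p q : P) : p = q.
Proof.
have e : P = True by apply: propositional_extensionality; split.
by move: p q; rewrite e => -[] [].
Qed.

Record cring : Type := CRing {
  car :> Type;
  czero : car;
  cone : car;
  cadd : car -> car -> car;
  cmul : car -> car -> car;
  copp : car -> car;
  cring_th : ring_theory czero cone cadd cmul (fun x y => cadd x (copp y))
               copp (@eq car)
}.

Declare Scope cring_scope.
Delimit Scope cring_scope with cr.
Bind Scope cring_scope with car.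
Arguments cadd {_} _%_cring_scope _%_cring_scope : simpl never.
Arguments cmul {_} _%_cring_scope _%_cring_scope : simpl never.
Arguments copp {_} _%_cring_scope : simpl never.
Arguments czero {_} : simpl never.
Arguments cone {_} : simpl never.
Notation "0" := czero : cring_scope.
Notation "1" := cone : cring_scope.
Notation "x + y" := (cadd x y) : cring_scope.
Notation "x * y" := (cmul x y) : cring_scope.
Notation "- x" := (copp x) : cring_scope.
Notation "x - y" := (cadd x (copp y)) : cring_scope.

Definition csum (A : cring) (n : nat) (F : 'I_n -> A) : A :=
  \big[cadd/0%cr]_(i < n) F i.

Definition cexp (A : cring) (x : A) (k : nat) : A := iter k (cmul x) 1%cr.

Definition invertible (A : cring) (x : A) : Prop :=
  exists y : A, (x * y = 1)%cr.

Definition nilpotent (A : cring) (x : A) : Prop :=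
  exists k : nat, cexp x k = 0%cr.

Definition in_ideal (A : cring) (n : nat) (f : 'I_n -> A) (a : A) : Prop :=
  exists c : 'I_n -> A, a = csum (fun i => c i * f i)%cr.

Definition det (A : cring) (n : nat) (M : 'I_n -> 'I_n -> A) : A :=
  \big[cadd/0%cr]_(s : 'S_n)
     (let p := \big[cmul/1%cr]_(i < n) M i (s i) in
      if odd_perm s then - p else p)%cr.

Record ring_hom (A B : cring) : Type := RingHom {
  hom_fun :> A -> B;
  hom_1 : hom_fun 1%cr = 1%cr;
  hom_add : forall x y, hom_fun (x + y)%cr = (hom_fun x + hom_fun y)%cr;
  hom_mul : forall x y, hom_fun (x * y)%cr = (hom_fun x * hom_fun y)%cr
}.

Definition local_ring (R : cring) : Prop :=
  (1 : R)%cr <> 0%cr /\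
  forall x y : R, invertible (x + y)%cr -> invertible x \/ invertible y.

Record alg (R : cring) : Type := Alg {
  alg_ring :> cring;
  alg_map : ring_hom R alg_ring
}.
Arguments alg_map {R} _.

Record alg_hom (R : cring) (A B : alg R) : Type := AlgHom {
  alg_hom_ring :> ring_hom A B;
  alg_hom_map : forall r, alg_hom_ring (alg_map A r) = alg_map B r
}.

Definition is_alg_iso (R : cring) (A B : alg R) (f : alg_hom A B) : Prop :=
  exists g : alg_hom B A, (forall x, g (f x) = x) /\ (forall y, f (g y) = y).

Definition alg_iso (R : cring) (A B : alg R) : Prop :=
  exists f : alg_hom A B, is_alg_iso f.

Definition id_hom (A : cring) : ring_hom A A :=
  @RingHom A A (fun x => x) (erefl _) (fun _ _ => erefl _) (fun _ _ => erefl _).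

Program Definition comp_hom (A B C : cring) (g : ring_hom B C)
    (f : ring_hom A B) : ring_hom A C :=
  @RingHom A C (fun x => g (f x)) _ _ _.
Next Obligation. by move=> A B C g f; rewrite /= !hom_1. Qed.
Next Obligation. by move=> A B C g f x y; rewrite /= !hom_add. Qed.
Next Obligation. by move=> A B C g f x y; rewrite /= !hom_mul. Qed.

Definition base_alg (R : cring) : alg R := @Alg R R (id_hom R).

Definition Spec (R : cring) (A : alg R) : Type := alg_hom A (base_alg R).

Program Definition fun_ring (X : Type) (A : cring) : cring :=
  @CRing (X -> A) (fun _ => 0%cr) (fun _ => 1%cr)
    (fun f g x => f x + g x)%cr (fun f g x => f x * g x)%cr
    (fun f x => - f x)%cr _.
Next Obligation.
by move=> X A; split=> *; apply: functional_extensionality => ?; apply cring_th.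
Qed.

Program Definition fun_alg (R : cring) (X : Type) : alg R :=
  @Alg R (fun_ring X R) (@RingHom _ (fun_ring X R) (fun r _ => r) _ _ _).

Program Definition ev_hom (R : cring) (A : alg R) :
    alg_hom A (fun_alg R (Spec A)) :=
  @AlgHom R A (fun_alg R (Spec A))
    (@RingHom A (fun_ring (Spec A) R) (fun a x => x a) _ _ _) _.
Next Obligation.
by move=> R A; apply: functional_extensionality => x; apply: hom_1.
Qed.
Next Obligation.
by move=> R A a b; apply: functional_extensionality => x; apply: hom_add.
Qed.
Next Obligation.
by move=> R A a b; apply: functional_extensionality => x; apply: hom_mul.
Qed.
Next Obligation.
by move=> R A r; apply: functional_extensionality => x; exact: (alg_hom_map x r).
Qed.

(** The set quotient [T / E], as the type of equivalence classes. *)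
Record quot (T : Type) (E : T -> T -> Prop) : Type := Quot {
  cls :> T -> Prop;
  cls_ex : exists t, forall u, cls u <-> E t u
}.

Section Quotient.
Context (T : Type) (E : T -> T -> Prop) (eqE : Equivalence E).

Lemma quot_eq (S S' : quot E) : (forall t, S t <-> S' t) -> S = S'.
Proof.
case: S S' => [S hS] [S' hS'] /= h.
have e : S = S'.
  by apply: functional_extensionality => t; apply: propositional_extensionality.
by move: hS hS'; rewrite -e => hS hS'; rewrite (prop_irrel hS hS').
Qed.

Definition qcl (t : T) : quot E :=
  @Quot T E (E t) (ex_intro _ t (fun u => iff_refl (E t u))).

Lemma qcl_eq t u : E t u -> qcl t = qcl u.
Proof.
move=> h; apply: quot_eq => v /=; split=> h'; last by transitivity u.
by transitivity t => //; symmetry.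
Qed.

Lemma qcl_inj t u : qcl t = qcl u -> E t u.
Proof. by move=> h; change (cls (qcl t) u); rewrite h /=; reflexivity. Qed.

Lemma qcl_surj (S : quot E) : exists t, S = qcl t.
Proof. by case: (cls_ex S) => t ht; exists t; apply: quot_eq. Qed.

Lemma cls_qcl (t : T) (S : quot E) : S t -> S = qcl t.
Proof. by case: (qcl_surj S) => u -> /= h; apply: qcl_eq. Qed.

End Quotient.

Section QuotientMap.
Context (T : Type) (E : T -> T -> Prop) (eqE : Equivalence E).
Context (T' : Type) (E' : T' -> T' -> Prop).
Context (f : T -> quot E') (fE : forall t u, E t u -> f t = f u).

Lemma qlift_subproof (S : quot E) :
  exists t', forall u', (exists t, S t /\ f t u') <-> E' t' u'.
Proof.
case: (qcl_surj S) => t ->; case: (cls_ex (f t)) => t' ht'.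
exists t' => u'; rewrite -ht'; split=> [[u [/= h]]|h]; first by rewrite (fE h).
by exists t; split=> //=; reflexivity.
Qed.

Definition qlift (S : quot E) : quot E' := Quot (qlift_subproof S).

Lemma qlift_cl (t : T) : qlift (qcl E t) = f t.
Proof.
apply: quot_eq => u' /=; split=> [[u [h]]|h]; first by rewrite (fE h).
by exists t; split=> //=; reflexivity.
Qed.

End QuotientMap.

Section QuotientRing.
Context (T : Type) (z o : T) (ad mu : T -> T -> T) (op : T -> T).
Context (E : T -> T -> Prop) (eqE : Equivalence E).
Context (ext : ring_eq_ext ad mu op E).
Context (th : ring_theory z o ad mu (fun x y => ad x (op y)) op E).

Lemma qop_compat (h : T -> T) (hE : forall t u, E t u -> E (h t) (h u)) t u :
  E t u -> qcl E (h t) = qcl E (h u).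
Proof. by move=> ?; apply: (qcl_eq eqE); apply: hE. Qed.

Definition qopp : quot E -> quot E :=
  qlift eqE (qop_compat (fun t u (h : E t u) => Ropp_ext ext t u h)).

Lemma qadd_compat1 t u v : E u v -> E (ad t u) (ad t v).
Proof. by move=> h; apply: (Radd_ext ext) => //; reflexivity. Qed.

Lemma qmul_compat1 t u v : E u v -> E (mu t u) (mu t v).
Proof. by move=> h; apply: (Rmul_ext ext) => //; reflexivity. Qed.

Definition qadd1 (t : T) : quot E -> quot E :=
  qlift eqE (qop_compat (@qadd_compat1 t)).

Definition qmul1 (t : T) : quot E -> quot E :=
  qlift eqE (qop_compat (@qmul_compat1 t)).

Lemma qadd_compat2 (S : quot E) t u : E t u -> qadd1 t S = qadd1 u S.
Proof.
move=> h; case: (qcl_surj S) => v ->; rewrite /qadd1 !qlift_cl.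
by apply: (qcl_eq eqE); apply: (Radd_ext ext) => //; reflexivity.
Qed.

Lemma qmul_compat2 (S : quot E) t u : E t u -> qmul1 t S = qmul1 u S.
Proof.
move=> h; case: (qcl_surj S) => v ->; rewrite /qmul1 !qlift_cl.
by apply: (qcl_eq eqE); apply: (Rmul_ext ext) => //; reflexivity.
Qed.

Definition qadd (S S' : quot E) : quot E := qlift eqE (@qadd_compat2 S') S.
Definition qmul (S S' : quot E) : quot E := qlift eqE (@qmul_compat2 S') S.

Lemma qopp_cl t : qopp (qcl E t) = qcl E (op t).
Proof. by rewrite /qopp qlift_cl. Qed.

Lemma qadd_cl t u : qadd (qcl E t) (qcl E u) = qcl E (ad t u).
Proof. by rewrite /qadd qlift_cl /qadd1 qlift_cl. Qed.

Lemma qmul_cl t u : qmul (qcl E t) (qcl E u) = qcl E (mu t u).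
Proof. by rewrite /qmul qlift_cl /qmul1 qlift_cl. Qed.

Lemma quot_ring_th :
  ring_theory (qcl E z) (qcl E o) qadd qmul (fun x y => qadd x (qopp y)) qopp
    (@eq (quot E)).
Proof.
split; repeat (let x := fresh in move=> x; case: (qcl_surj x) => ? ->);
  rewrite ?(qopp_cl, qadd_cl, qmul_cl) //; apply: (qcl_eq eqE); apply th.
Qed.

Definition quot_ring : cring := CRing quot_ring_th.

End QuotientRing.

Section IdealQuotient.
Context (A : cring) (n : nat) (f : 'I_n -> A).

Add Ring Aring : (cring_th A).

Lemma csum_opp (F : 'I_n -> A) : (- csum F)%cr = csum (fun i => - F i)%cr.
Proof.
rewrite /csum; apply: (big_morph (@copp A)); last by ring.
by move=> x y; ring.
Qed.

Lemma csum_mul (a : A) (F : 'I_n -> A) :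
  (a * csum F)%cr = csum (fun i => a * F i)%cr.
Proof.
rewrite /csum; apply: (big_morph (cmul a)); last by ring.
by move=> x y; ring.
Qed.

Lemma csum_add (F G : 'I_n -> A) :
  (csum F + csum G)%cr = csum (fun i => F i + G i)%cr.
Proof.
rewrite /csum; elim/big_ind3: _ => [|x1 x2 y1 y2 z1 z2 <- <-|] //; last 1 first.
- by ring.
- by ring.
Qed.

Lemma in_ideal0 : in_ideal f 0%cr.
Proof.
exists (fun _ => 0%cr); rewrite /csum; elim/big_ind: _ => [|x y <- <-|i _] //;
by ring.
Qed.

Lemma in_ideal_opp a : in_ideal f a -> in_ideal f (- a)%cr.
Proof.
case=> c ->; exists (fun i => - c i)%cr; rewrite csum_opp /csum.
by apply: eq_bigr => i _; ring.
Qed.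

Lemma in_ideal_add a b : in_ideal f a -> in_ideal f b -> in_ideal f (a + b)%cr.
Proof.
case=> c -> [d ->]; exists (fun i => c i + d i)%cr; rewrite csum_add /csum.
by apply: eq_bigr => i _; ring.
Qed.

Lemma in_ideal_mul a b : in_ideal f b -> in_ideal f (a * b)%cr.
Proof.
case=> c ->; exists (fun i => a * c i)%cr; rewrite csum_mul /csum.
by apply: eq_bigr => i _; ring.
Qed.

Definition eq_mod (a b : A) : Prop := in_ideal f (a - b)%cr.

Lemma eq_mod_eq a b : a = b -> eq_mod a b.
Proof.
by move=> ->; rewrite /eq_mod; have -> : (b - b = 0)%cr by [ring];
  apply: in_ideal0.
Qed.

Lemma eq_mod_equiv : Equivalence eq_mod.
Proof.
split=> [a|a b h|a b c h h']; first exact: eq_mod_eq.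
- rewrite /eq_mod; have -> : (b - a = - (a - b))%cr by ring.
  exact: in_ideal_opp.
- rewrite /eq_mod; have -> : (a - c = (a - b) + (b - c))%cr by ring.
  exact: in_ideal_add.
Qed.

Lemma eq_mod_ext : ring_eq_ext (@cadd A) (@cmul A) (@copp A) eq_mod.
Proof.
split=> [a b h c d h'|a b h c d h'|a b h]; rewrite /eq_mod.
- have -> : (a + c - (b + d) = (a - b) + (c - d))%cr by ring.
  exact: in_ideal_add.
- have -> : (a * c - b * d = a * (c - d) + d * (a - b))%cr by ring.
  by apply: in_ideal_add; apply: in_ideal_mul.
- have -> : (- a - - b = - (a - b))%cr by ring.
  exact: in_ideal_opp.
Qed.

Lemma eq_mod_th :
  ring_theory (0%cr : A) 1%cr (@cadd A) (@cmul A) (fun x y => x - y)%cr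
    (@copp A) eq_mod.
Proof. by split=> *; apply: eq_mod_eq; ring. Qed.

Definition ideal_quot : cring := quot_ring eq_mod_equiv eq_mod_ext eq_mod_th.

Program Definition ideal_proj : ring_hom A ideal_quot :=
  @RingHom A ideal_quot (qcl eq_mod) (erefl _) _ _.
Next Obligation. by move=> x y; symmetry; apply: qadd_cl. Qed.
Next Obligation. by move=> x y; symmetry; apply: qmul_cl. Qed.

End IdealQuotient.

(** [R[X_1, ..., X_n]] is the free commutative [R]-algebra on ['I_n]:
    expressions modulo the congruence [peq] generated by the ring laws and by
    the compatibility of [PConst] with the operations of [R]. *)
Inductive pterm (R : cring) (n : nat) : Type :=
| PConst of R
| PVar of 'I_n
| PAdd of pterm R n & pterm R n
| PMul of pterm R n & pterm R n
| POpp of pterm R n.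

Arguments PConst {R n} _%_cring_scope.
Arguments PVar {R n} _.

Inductive peq (R : cring) (n : nat) : pterm R n -> pterm R n -> Prop :=
| peq_refl t : peq t t
| peq_sym t u : peq t u -> peq u t
| peq_trans t u v : peq t u -> peq u v -> peq t v
| peq_add t t' u u' : peq t t' -> peq u u' -> peq (PAdd t u) (PAdd t' u')
| peq_mul t t' u u' : peq t t' -> peq u u' -> peq (PMul t u) (PMul t' u')
| peq_opp t t' : peq t t' -> peq (POpp t) (POpp t')
| peq_add0 t : peq (PAdd (PConst 0) t) t
| peq_addC t u : peq (PAdd t u) (PAdd u t)
| peq_addA t u v : peq (PAdd t (PAdd u v)) (PAdd (PAdd t u) v)
| peq_addN t : peq (PAdd t (POpp t)) (PConst 0)
| peq_mul1 t : peq (PMul (PConst 1) t) t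
| peq_mulC t u : peq (PMul t u) (PMul u t)
| peq_mulA t u v : peq (PMul t (PMul u v)) (PMul (PMul t u) v)
| peq_mulDl t u v : peq (PMul (PAdd t u) v) (PAdd (PMul t v) (PMul u v))
| peq_constD r s : peq (PConst (r + s)) (PAdd (PConst r) (PConst s))
| peq_constM r s : peq (PConst (r * s)) (PMul (PConst r) (PConst s)).

Section Polynomials.
Context (R : cring) (n : nat).

Lemma peq_equiv : Equivalence (@peq R n).
Proof. split; [exact: peq_refl|exact: peq_sym|exact: peq_trans]. Qed.

Lemma peq_ext : ring_eq_ext (@PAdd R n) (@PMul R n) (@POpp R n) (@peq R n).
Proof.
split=> [t t' h u u' h'|t t' h u u' h'|t t' h].
- exact: peq_add.
- exact: peq_mul.
- exact: peq_opp.
Qed.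

Lemma peq_th :
  ring_theory (PConst 0) (PConst 1) (@PAdd R n) (@PMul R n)
    (fun x y => PAdd x (POpp y)) (@POpp R n) (@peq R n).
Proof. by split; constructor. Qed.

Definition poly_ring : cring := quot_ring peq_equiv peq_ext peq_th.

Definition pclass (t : pterm R n) : poly_ring := qcl (@peq R n) t.

Lemma pclassD t u : pclass (PAdd t u) = (pclass t + pclass u)%cr.
Proof. by symmetry; apply: qadd_cl. Qed.

Lemma pclassM t u : pclass (PMul t u) = (pclass t * pclass u)%cr.
Proof. by symmetry; apply: qmul_cl. Qed.

Lemma pclassN t : pclass (POpp t) = (- pclass t)%cr.
Proof. by symmetry; apply: qopp_cl. Qed.

Program Definition poly_alg : alg R :=
  @Alg R poly_ring (@RingHom R poly_ring (fun r => pclass (PConst r)) _ _ _).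
Next Obligation.
by move=> r s; rewrite -pclassD; apply: (qcl_eq peq_equiv); apply: peq_constD.
Qed.
Next Obligation.
by move=> r s; rewrite -pclassM; apply: (qcl_eq peq_equiv); apply: peq_constM.
Qed.

Definition pvar (i : 'I_n) : poly_alg := pclass (PVar i).

Add Ring Pring : (cring_th poly_ring).

Fixpoint pterm_deriv (j : 'I_n) (t : pterm R n) : poly_ring :=
  match t with
  | PConst _ => 0
  | PVar i => if i == j then 1 else 0
  | PAdd t u => pterm_deriv j t + pterm_deriv j u
  | PMul t u => pterm_deriv j t * pclass u + pclass t * pterm_deriv j u
  | POpp t => - pterm_deriv j t
  end%cr.

Lemma pterm_deriv_peq (j : 'I_n) t u :
  peq t u -> pterm_deriv j t = pterm_deriv j u.
Proof.
have cl t' u' : peq t' u' -> pclass t' = pclass u'.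
  by move=> h; apply: (qcl_eq peq_equiv).
have e1 : pclass (PConst 1) = 1%cr by [].
elim=> {t u}; cbn [pterm_deriv];
  try (by move=> *; rewrite ?pclassD ?pclassM ?e1; ring).
- by move=> t u _ ->.
- by move=> t u v _ -> _ ->.
- by move=> t t' u u' _ -> _ ->.
- by move=> t t' u u' /cl -> -> /cl -> ->.
- by move=> t t' _ ->.
Qed.

Definition pderiv (j : 'I_n) : poly_alg -> poly_alg :=
  qlift peq_equiv (@pterm_deriv_peq j).

Definition poly_quot (l : nat) (P : 'I_l -> poly_alg) : alg R :=
  @Alg R (ideal_quot P) (comp_hom (ideal_proj P) (alg_map poly_alg)).

Definition jacobian (P : 'I_n -> poly_alg) (i j : 'I_n) : poly_alg :=
  pderiv j (P i).

End Polynomials.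

Definition finitely_presented (R : cring) (A : alg R) : Prop :=
  exists (n l : nat) (P : 'I_l -> poly_alg R n), alg_iso A (poly_quot P).

Definition duality (R : cring) : Prop :=
  forall A : alg R, finitely_presented A -> is_alg_iso (ev_hom A).

Definition basic_open (R : cring) (A : alg R) (f : A) : Type :=
  {x : Spec A | invertible (x f)}.

Definition zariski_local_choice (R : cring) : Prop :=
  forall A : alg R, finitely_presented A ->
  forall B : Spec A -> Type, (forall x, inhabited (B x)) ->
  exists (n : nat) (f : 'I_n -> A),
    in_ideal f 1%cr /\
    inhabited (forall (i : 'I_n) (x : basic_open (f i)), B (proj1_sig x)).

Definition open_prop (R : cring) (Q : Prop) : Prop :=
  exists (n : nat) (r : 'I_n -> R), Q <-> exists i, r i <> 0%cr.

Definition closed_dense (R : cring) (Q : Prop) : Prop :=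
  exists (n : nat) (r : 'I_n -> R),
    (forall i, nilpotent (r i)) /\ (Q <-> forall i, r i = 0%cr).

Definition affine_scheme (R : cring) (X : Type) : Prop :=
  exists A : alg R, finitely_presented A /\ type_equiv X (Spec A).

Definition scheme (R : cring) (X : Type) : Prop :=
  exists (n : nat) (U : 'I_n -> X -> Prop),
    [/\ forall i x, open_prop R (U i x),
        forall i, affine_scheme R {x : X | U i x} &
        forall x, exists i, U i x].

Definition formally_etale (R : cring) (X : Type) : Prop :=
  forall P : Prop, closed_dense R P -> is_equiv (fun (x : X) (_ : P) => x).

Definition etale_scheme (R : cring) (X : Type) : Prop :=
  scheme R X /\ formally_etale R X.

Definition standard_etale_scheme (R : cring) (X : Type) : Prop :=
  exists (n : nat) (P : 'I_n -> poly_alg R n),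
    invertible (ideal_proj P (det (jacobian P))) /\
    type_equiv X (Spec (poly_quot P)).

(* Main.v *)
From HB Require Import structures.
From Stdlib Require Import FunctionalExtensionality PropExtensionality.
From Stdlib Require Import RelationClasses Ring.
From mathcomp Require Import all_boot fingroup perm.
Require Import Defs.

Set Implicit Arguments.
Unset Strict Implicit.
Unset Printing Implicit Defensive.

(** Only formal etaleness has content: the scheme [X] is covered by itself, and
    this cover is open because [1 <> 0] in [R].

    Let a closed dense proposition be given by the vanishing of nilpotents
    [r_1, ..., r_k], and let [I] be the ideal they generate.  Duality for the
    algebra [R / I] translates statements about this proposition into algebra.
    The points of [Spec (R / I)] are the proofs that all [r_i] vanish, so a map
    from the proposition to [R] is a function on [Spec (R / I)], hence the class
    of an element of [R] ([closed_fun_constant]); and an element that vanishes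
    as soon as the [r_i] do represents the function 0, hence lies in [I]
    ([closed_zero_in_ideal]).

    A point of [Spec (R[X_1, ..., X_n] / (P_1, ..., P_n))] is a common root of
    the [P_i] in [R].  A root that depends on a proof of the proposition is thus
    the same as a tuple [x] of elements of [R] with all [P_i(x)] in [I], and it
    remains to show that exactly one root in [R] is congruent to [x] modulo [I].
    This is Hensel's lemma for a nilpotent ideal.  The Jacobian determinant is
    invertible at [x], since it is so modulo [I].  By Taylor's formula the Newton
    step [x - J(x)^-1 P(x)] improves [P_i(x)] in [I^(m+1)] to [I^(m+2)]
    ([newton_step]), and the same formula shows that the difference of two
    congruent roots lies in every power of [I] ([root_lift_unique]).  As [I] is
    finitely generated by nilpotents, some power of it is 0
    ([ideal_pow_nilpotent]).

    The points constructed this way are only known to exist.  Being unique, they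
    are extracted with the eliminator of the truncation ([unique_choice]); the
    axiom of choice is never used. *)

(** * Finite and unique choice *)

(** Provable by induction on [n], unlike choice over an arbitrary type. *)
Lemma fin_choice n (T : Type) (Q : 'I_n -> T -> Prop) :
  (forall i, exists x, Q i x) -> exists f : 'I_n -> T, forall i, Q i (f i).
Proof.
elim: n Q => [|n IH] Q h.
  by exists (fun i : 'I_0 => False_rect T (notF (ltn_ord i))) => -[].
have [x hx] := h ord0; have [f hf] := IH (fun i => Q (lift ord0 i)) (fun i => h _).
exists (fun i => if unlift ord0 i is Some j then f j else x) => i.
by case: unliftP => [j ->|->].
Qed.

(** Uniqueness makes the type of values at [x] a mere proposition, so that a
    value can be extracted from the truncation. *)
Lemma unique_choice (trunc_elim : prop_trunc_elim) (X Y : Type)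
    (Q : X -> Y -> Prop) (Q_ex : forall x, exists y, Q x y)
    (Q_uniq : forall x y z, Q x y -> Q x z -> y = z) :
  exists f : X -> Y, forall x, Q x (f x).
Proof.
have sub x (u v : {y | Q x y}) : u = v.
  case: u v => [y hy] [z hz]; have e := Q_uniq _ _ _ hy hz; subst z.
  by rewrite (prop_irrel hy hz).
have inh x : inhabited {y | Q x y} by case: (Q_ex x) => y hy; split; exists y.
pose f x := trunc_elim _ _ (sub x) (fun u => u) (inh x).
by exists (fun x => proj1_sig (f x)) => x; apply: proj2_sig.
Qed.

(** An element of [quot E] is a class without a chosen representative, so a
    function out of it into a type that is not a proposition comes from unique
    choice. *)
Lemma quot_rec (trunc_elim : prop_trunc_elim) (T B : Type) (E : T -> T -> Prop)
    (eqE : Equivalence E) (f : T -> B) (fE : forall t u, E t u -> f t = f u) :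
  exists g : quot E -> B, forall t, g (qcl E t) = f t.
Proof.
have [||g hg] := unique_choice trunc_elim
  (Q := fun (S : quot E) y => exists t, S = qcl E t /\ y = f t).
- by move=> S; case: (qcl_surj S) => t ->; exists (f t); exists t.
- by move=> S y z [t [-> ->]] [u [/(qcl_inj eqE) /fE -> ->]].
exists g => t; case: (hg (qcl E t)) => u [/(qcl_inj eqE) /fE -> ->].
by [].
Qed.

(** * Sums in commutative rings *)

HB.instance Definition _ (A : cring) :=
  Monoid.isComLaw.Build A 0%cr (@cadd A)
    (Radd_assoc (cring_th A)) (Radd_comm (cring_th A)) (Radd_0_l (cring_th A)).

HB.instance Definition _ (A : cring) :=
  Monoid.isComLaw.Build A 1%cr (@cmul A)
    (Rmul_assoc (cring_th A)) (Rmul_comm (cring_th A)) (Rmul_1_l (cring_th A)).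

Section CringTheory.
Context (A : cring).
Add Ring CringRing : (cring_th A).

Lemma cmul_suml (I : finType) (P : pred I) (F : I -> A) (a : A) :
  (a * \big[cadd/0]_(i | P i) F i = \big[cadd/0]_(i | P i) (a * F i))%cr.
Proof. by apply: (big_morph (cmul a)) => [x y|]; ring. Qed.

Lemma csub0 (a : A) : (a - 0 = a)%cr. Proof. by ring. Qed.

Lemma csum0 n : csum (fun _ : 'I_n => 0%cr : A) = 0%cr.
Proof. by rewrite /csum big1. Qed.

Lemma csum_delta n (F : 'I_n -> A) (i : 'I_n) :
  csum (fun j => (if i == j then 1 else 0) * F j)%cr = F i.
Proof.
rewrite /csum (bigD1 i) //= eqxx big1 => [|j /negPf]; first by ring.
by rewrite eq_sym => ->; ring.
Qed.

Lemma csum_exchange n m (F : 'I_n -> 'I_m -> A) :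
  csum (fun i => csum (F i)) = csum (fun j => csum (fun i => F i j)).
Proof. exact: exchange_big. Qed.

Lemma eq_csum n (F G : 'I_n -> A) : (forall i, F i = G i) -> csum F = csum G.
Proof. by move=> h; apply: eq_bigr => i _; apply: h. Qed.

Lemma csub_eq0 (x y : A) : (x - y = 0)%cr -> x = y.
Proof. by move=> h; have -> : (x = (x - y) + y)%cr by [ring]; rewrite h; ring. Qed.

(** * Determinants and Cramer's rule *)

Section Determinants.
Context (n : nat).
Implicit Types (M N : 'I_n -> 'I_n -> A).

Lemma det_tr M : det (fun i j => M j i) = det M.
Proof.
rewrite /det (reindex_inj invg_inj); apply: eq_bigr => s _ /=.
rewrite odd_permV.
have -> // : \big[cmul/1%cr]_(i < n) M (s^-1%g i) i =
             \big[cmul/1%cr]_(i < n) M i (s i).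
rewrite (reindex_inj (@perm_inj _ s)); apply: eq_bigr => i _.
by rewrite permK.
Qed.

(** Multiplication by the transposition of [i1] and [i2] matches each odd
    permutation with an even one whose term is the opposite; splitting the sum
    by parity avoids dividing by 2. *)
Lemma det_alternate M i1 i2 : i1 != i2 -> (forall j, M i1 j = M i2 j) ->
  det M = 0%cr.
Proof.
move=> ne e; pose t := tperm i1 i2.
have oddMt (s : 'S_n) : odd_perm (t * s)%g = ~~ odd_perm s.
  by rewrite odd_permM odd_tperm ne.
rewrite /det (bigID (@odd_perm _)) /= (reindex_inj (mulgI t)) /=.
match goal with |- (?S + ?S' = _)%cr => set S1 := S; set S2 := S' end.
suff -> : S1 = (- S2)%cr by ring.
have -> : (- S2 = \big[cadd/0]_(s : 'S_n | ~~ odd_perm s)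
   - (if odd_perm s then - \big[cmul/1]_(i < n) M i (s i)
      else \big[cmul/1]_(i < n) M i (s i)))%cr.
  by apply: (big_morph (@copp A)) => [x y|]; ring.
apply: eq_big => s; first exact: oddMt.
rewrite oddMt => h; rewrite h (negPf h); congr (- _)%cr.
rewrite (reindex_inj (@perm_inj _ t)); apply: eq_bigr => i _ /=.
by rewrite permM tpermK /t; case: tpermP => // ->.
Qed.

(** The coefficient of [M i0 k] in the Leibniz formula, rather than the signed
    determinant of a minor: no reindexing of ['I_n] is needed to expand a row. *)
Definition cofactor M (i0 k : 'I_n) : A :=
  \big[cadd/0%cr]_(s : 'S_n | s i0 == k)
     (let p := \big[cmul/1%cr]_(i < n | i != i0) M i (s i) in
      if odd_perm s then - p else p)%cr.

Lemma det_expand_row M i0 (v : 'I_n -> A) :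
  csum (fun k => v k * cofactor M i0 k)%cr =
  det (fun i => if i == i0 then v else M i).
Proof.
rewrite /csum /det (partition_big (fun s : 'S_n => s i0) predT) //=.
apply: eq_bigr => k _; rewrite /cofactor cmul_suml; apply: eq_bigr => s /eqP <-.
rewrite [in RHS](bigD1 i0) //= eqxx.
have -> : \big[cmul/1%cr]_(i < n | i != i0)
            (if i == i0 then v else M i) (s i) =
          \big[cmul/1%cr]_(i < n | i != i0) M i (s i).
  by apply: eq_bigr => i /negPf ->.
by case: odd_perm => /=; ring.
Qed.

(** The sum is the determinant of [M] with row [l] replaced by row [i], so it
    has two equal rows unless [i] is [l]. *)
Lemma cramer M i l :
  csum (fun k => M i k * cofactor M l k)%cr = if i == l then det M else 0%cr.
Proof.
rewrite det_expand_row; have [<-|ne] := eqVneq i l.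
  rewrite /det; apply: eq_bigr => s _.
  have -> // : \big[cmul/1%cr]_(j < n) (if j == i then M i else M j) (s j) =
               \big[cmul/1%cr]_(j < n) M j (s j).
  by apply: eq_bigr => j _; case: eqP => // ->.
by apply: (det_alternate ne) => j; rewrite eqxx (negPf ne).
Qed.

Lemma det_right_inverse M : invertible (det M) ->
  exists N, forall i l,
    csum (fun k => M i k * N k l)%cr = if i == l then 1%cr else 0%cr.
Proof.
case=> u hu; exists (fun k l => u * cofactor M l k)%cr => i l.
transitivity (u * csum (fun k => M i k * cofactor M l k))%cr.
  by rewrite csum_mul; apply: eq_csum => k; ring.
by rewrite cramer; case: eqP => _; rewrite -?hu; ring.
Qed.

(** A right inverse of the transpose, transposed. *)
Lemma det_left_inverse M : invertible (det M) ->
  exists N, forall i l,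
    csum (fun k => N i k * M k l)%cr = if i == l then 1%cr else 0%cr.
Proof.
rewrite -det_tr => /det_right_inverse [N hN].
exists (fun i k => N k i) => i l; rewrite eq_sym -hN.
by apply: eq_csum => k; ring.
Qed.

End Determinants.

(** * Ideals and their powers *)

(** Ideals are arbitrary predicates, so that congruences modulo powers of a
    finitely generated ideal are treated uniformly. *)
Record is_ideal (K : A -> Prop) : Prop := IsIdeal {
  ideal0 : K 0%cr;
  idealD : forall a b, K a -> K b -> K (a + b)%cr;
  idealM : forall a b, K b -> K (a * b)%cr
}.

Section Ideals.
Context (K : A -> Prop) (idK : is_ideal K).

Lemma ideal_opp a : K a -> K (- a)%cr.
Proof.
by move=> h; have -> : (- a = copp 1 * a)%cr by [ring]; apply: idealM.
Qed.

Lemma ideal_sum n (F : 'I_n -> A) : (forall i, K (F i)) -> K (csum F).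
Proof.
move=> h; apply: (big_ind K) => //; [exact: ideal0|exact: idealD].
Qed.

Lemma solve_in_ideal n (M : 'I_n -> 'I_n -> A) (v : 'I_n -> A) :
  invertible (det M) -> (forall i, K (v i)) ->
  exists w, (forall j, K (w j)) /\
    forall i, csum (fun j => M i j * w j)%cr = v i.
Proof.
move=> /det_right_inverse [N hN] hv.
exists (fun j => csum (fun l => N j l * v l)%cr); split=> [j|i].
  by apply: ideal_sum => l; apply: idealM.
rewrite -(csum_delta v i).
transitivity (csum (fun j => csum (fun l => M i j * N j l * v l))%cr).
  by apply: eq_csum => j; rewrite csum_mul; apply: eq_csum => l; ring.
rewrite csum_exchange; apply: eq_csum => l; rewrite -hN.
have -> a b : (a * b = b * a :> A)%cr by ring.
by rewrite csum_mul; apply: eq_csum => j; ring.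
Qed.

(** Multiply by a left inverse of the matrix, whose entries preserve [K]. *)
Lemma cancel_in_ideal n (M : 'I_n -> 'I_n -> A) (d : 'I_n -> A) :
  invertible (det M) -> (forall i, K (csum (fun j => M i j * d j)%cr)) ->
  forall j, K (d j).
Proof.
move=> /det_left_inverse [N hN] hd j.
rewrite -(csum_delta d j).
suff -> : csum (fun l => (if j == l then 1 else 0) * d l)%cr =
          csum (fun i => N j i * csum (fun l => M i l * d l))%cr.
  by apply: ideal_sum => i; apply: idealM.
transitivity (csum (fun i => csum (fun l => N j i * M i l * d l))%cr); last first.
  by apply: eq_csum => i; rewrite csum_mul; apply: eq_csum => l; ring.
rewrite csum_exchange; apply: eq_csum => l; rewrite -hN.
have -> a b : (a * b = b * a :> A)%cr by ring.
by rewrite csum_mul; apply: eq_csum => i; ring.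
Qed.

End Ideals.

Section IdealPowers.
Context (k : nat) (r : 'I_k -> A).

(** Multiplying by one generator at a time gives the powers of the ideal
    generated by [r] without sums over monomials. *)
Fixpoint ideal_pow (m : nat) (a : A) : Prop :=
  if m is m'.+1 then
    exists c : 'I_k -> A,
      (forall i, ideal_pow m' (c i)) /\ a = csum (fun i => c i * r i)%cr
  else True.

Lemma ideal_pow_ideal m : is_ideal (ideal_pow m).
Proof.
elim: m => [|m IH] //; split=> [|a b [c [hc ->]] [d [hd ->]]|a b [c [hc ->]]].
- exists (fun _ => 0%cr); split=> [_|]; first exact: (ideal0 IH).
  by rewrite -[LHS](csum0 k); apply: eq_csum => i; ring.
- exists (fun i => c i + d i)%cr; split=> [i|]; first exact: (idealD IH (hc i) (hd i)).
  by rewrite csum_add; apply: eq_csum => i; ring.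
- exists (fun i => a * c i)%cr; split=> [i|]; first exact: (idealM IH _ (hc i)).
  by rewrite csum_mul; apply: eq_csum => i; ring.
Qed.

Lemma ideal_pow_succ m a : ideal_pow m.+1 a -> ideal_pow m a.
Proof.
move=> [c [hc ->]]; apply: (ideal_sum (ideal_pow_ideal m)) => i.
have -> : (c i * r i = r i * c i)%cr by ring.
exact: (idealM (ideal_pow_ideal m) _ (hc i)).
Qed.

Lemma ideal_pow_sub1 m a : ideal_pow m.+1 a -> ideal_pow 1 a.
Proof. by elim: m => // m IH /ideal_pow_succ /IH. Qed.

Lemma ideal_pow_mul m a b :
  ideal_pow 1 a -> ideal_pow m b -> ideal_pow m.+1 (a * b)%cr.
Proof.
move=> [c [_ ->]] hb; exists (fun i => c i * b)%cr; split=> [i|].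
  exact: (idealM (ideal_pow_ideal m)).
have -> x y : (x * y = y * x :> A)%cr by ring.
by rewrite csum_mul; apply: eq_csum => i; ring.
Qed.

Lemma in_ideal_pow1 a : in_ideal r a -> ideal_pow 1 a.
Proof. by case=> c ->; exists c. Qed.

Lemma ideal_pow1_zero a : (forall i, r i = 0%cr) -> ideal_pow 1 a -> a = 0%cr.
Proof.
move=> r0 [c [_ ->]]; rewrite -(csum0 k); apply: eq_csum => i.
by rewrite r0; ring.
Qed.

(** Pigeonhole, with a factor [y] that makes the induction on the sum of the
    exponents go through: writing an element of the power as the sum of the
    [c_i r_i], the factor [y r_i] needs one power of [r_i] less to vanish, and
    [y] itself is 0 as soon as one of the exponents is. *)
Lemma ideal_pow_annihilated (e : 'I_k -> nat) (y a : A) :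
  (forall i, y * cexp (r i) (e i) = 0)%cr ->
  ideal_pow (\sum_i e i).+1 a -> (y * a = 0)%cr.
Proof.
move: {2}(\sum_i e i) (erefl (\sum_i e i)) => N.
elim: N e y a => [|N IH] e y a eN hy [c [hc ->]];
  rewrite csum_mul -(csum0 k); apply: eq_csum => i.
all: case ei: (e i) => [|f].
  (* An exponent 0 means that [y] vanishes. *)
all: try by move: (hy i); rewrite ei /cexp /= => h;
  have -> : (y * (c i * r i) = (y * 1) * (c i * r i))%cr by [ring]; rewrite h; ring.
  by move: eN; rewrite (bigD1 i) //= ei.
pose e' j := if j == i then f else e j.
have e'N : \sum_j e' j = N.
  apply: succn_inj; rewrite -eN (bigD1 i) //= [RHS](bigD1 i) //= /e' eqxx ei addSn.
  by congr (_ + _).+1; apply: eq_bigr => j /negPf ->.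
have -> : (y * (c i * r i) = (y * r i) * c i)%cr by ring.
apply: (IH e') => // [j|]; last by rewrite e'N -eN; apply: hc.
rewrite /e'; case: eqP => [->|_].
  rewrite -(hy i) ei [cexp _ f.+1]iterS -/(cexp (r i) f).
  by ring.
have -> : (y * r i * cexp (r j) (e j) = (y * cexp (r j) (e j)) * r i)%cr by ring.
by rewrite hy; ring.
Qed.

(** An element invertible modulo an ideal is invertible modulo its powers: if
    [q] and [c] are inverses of [y] modulo [I] and [I^m], then
    [c + q - y q c] is one modulo their product. *)
Lemma ideal_pow_unit (m : nat) (y q : A) :
  ideal_pow 1 (y * q - 1)%cr -> exists c, ideal_pow m (y * c - 1)%cr.
Proof.
move=> hq; elim: m => [|m [c hc]]; first by exists 0%cr.
exists (c + q - y * q * c)%cr.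
have -> : (y * (c + q - y * q * c) - 1 = - ((y * q - 1) * (y * c - 1)))%cr.
  by ring.
by apply: (ideal_opp (ideal_pow_ideal _)); apply: ideal_pow_mul.
Qed.

End IdealPowers.

End CringTheory.

(** The exponents of the [r_i] are only known to exist, whence the finite
    choice. *)
Lemma ideal_pow_nilpotent (A : cring) k (r : 'I_k -> A) :
  (forall i, nilpotent (r i)) ->
  exists m, forall a, ideal_pow r m a -> a = 0%cr.
Proof.
move=> /fin_choice [e he]; exists (\sum_i e i).+1 => a ha.
rewrite -(Rmul_1_l (cring_th A) a); apply: ideal_pow_annihilated ha => i.
by rewrite he (Rmul_1_l (cring_th A)).
Qed.

(** * Homomorphisms *)

Lemma hom_0 (A B : cring) (f : ring_hom A B) : f 0%cr = 0%cr.
Proof.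
have := hom_add f 0%cr 0%cr; rewrite (Radd_0_l (cring_th A)) => e.
have -> : 0%cr = (f 0 - f 0)%cr by rewrite (Ropp_def (cring_th B)).
rewrite {2}e -(Radd_assoc (cring_th B)) (Ropp_def (cring_th B)).
by rewrite (Radd_comm (cring_th B)) (Radd_0_l (cring_th B)).
Qed.

Lemma hom_opp (A B : cring) (f : ring_hom A B) x : f (- x)%cr = (- f x)%cr.
Proof.
have -> : (- f x)%cr = (- f x + f (x - x))%cr.
  rewrite (Ropp_def (cring_th A)) hom_0.
  by rewrite (Radd_comm (cring_th B)) (Radd_0_l (cring_th B)).
rewrite hom_add (Radd_assoc (cring_th B)) (Radd_comm (cring_th B) (- _)%cr).
by rewrite (Ropp_def (cring_th B)) (Radd_0_l (cring_th B)).
Qed.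

Lemma hom_csum (A B : cring) (f : ring_hom A B) n (F : 'I_n -> A) :
  f (csum F) = csum (fun i => f (F i)).
Proof. by apply: (big_morph f) => [x y|]; [apply: hom_add|apply: hom_0]. Qed.

Lemma hom_det (A B : cring) (f : ring_hom A B) n (M : 'I_n -> 'I_n -> A) :
  f (det M) = det (fun i j => f (M i j)).
Proof.
rewrite /det (big_morph f (@hom_add _ _ f) (hom_0 f)); apply: eq_bigr => s _.
have e : f (\big[cmul/1%cr]_(i < n) M i (s i)) =
         \big[cmul/1%cr]_(i < n) f (M i (s i)).
  exact: (big_morph f (@hom_mul _ _ f) (hom_1 f)).
by case: odd_perm; rewrite ?hom_opp e.
Qed.

(** The laws of a homomorphism are proofs of propositions, hence irrelevant. *)
Lemma alg_hom_eq (R : cring) (A B : alg R) (f g : alg_hom A B) :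
  (forall a, f a = g a) -> f = g.
Proof.
case: f g => [[f f1 fD fM] fm] [[g g1 gD gM] gm] /= e.
have e' : f = g by apply: functional_extensionality.
subst g; rewrite (prop_irrel f1 g1) (prop_irrel fD gD) (prop_irrel fM gM) in fm *.
by rewrite (prop_irrel fm gm).
Qed.

(** * Points of finitely presented algebras and Taylor's formula *)

Section Points.
Context (trunc_elim : prop_trunc_elim) (R : cring) (B : alg R).
Add Ring Bring : (cring_th B).

Fixpoint pterm_eval n (x : 'I_n -> B) (t : pterm R n) : B :=
  match t with
  | PConst r => alg_map B r
  | PVar i => x i
  | PAdd t u => pterm_eval x t + pterm_eval x u
  | PMul t u => pterm_eval x t * pterm_eval x u
  | POpp t => - pterm_eval x t
  end%cr.

Lemma pterm_eval_peq n (x : 'I_n -> B) t u :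
  peq t u -> pterm_eval x t = pterm_eval x u.
Proof.
elim=> {t u} /=;
  try (by move=> *; rewrite ?hom_0 ?hom_1 ?hom_add ?hom_mul; ring).
- by [].
- by move=> t u v _ -> _ ->.
- by move=> t t' u u' _ -> _ ->.
- by move=> t t' u u' _ -> _ ->.
- by move=> t t' _ ->.
Qed.

(** With [poly_hom_eq], the universal property of the polynomial algebra: its
    homomorphisms to [B] are the tuples of elements of [B].  A tuple is
    represented below by the evaluation at it. *)
Lemma poly_hom_exists n (x : 'I_n -> B) :
  exists f : alg_hom (poly_alg R n) B, forall i, f (pvar R i) = x i.
Proof.
have [g hg] := quot_rec trunc_elim (peq_equiv R n) (@pterm_eval_peq n x).
have g1 : g (1%cr : poly_ring R n) = 1%cr.
  by rewrite (hg (PConst 1%cr)) /= hom_1.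
have gD (p q : poly_ring R n) : g (p + q)%cr = (g p + g q)%cr.
  case: (qcl_surj p) (qcl_surj q) => [t ->] [u ->].
  by rewrite -[(_ + _)%cr]pclassD !hg.
have gM (p q : poly_ring R n) : g (p * q)%cr = (g p * g q)%cr.
  case: (qcl_surj p) (qcl_surj q) => [t ->] [u ->].
  by rewrite -[(_ * _)%cr]pclassM !hg.
unshelve eexists (@AlgHom R (poly_alg R n) B (@RingHom (poly_alg R n) B g g1 gD gM) _).
  by move=> r; apply: (hg (PConst r)).
by move=> i; apply: (hg (PVar i)).
Qed.

Lemma poly_hom_eq n (f g : alg_hom (poly_alg R n) B) :
  (forall i, f (pvar R i) = g (pvar R i)) -> forall p, f p = g p.
Proof.
move=> e p; case: (qcl_surj p) => t ->; rewrite -[qcl _ _]/(pclass t).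
elim: t => [r|i|t IHt u IHu|t IHt u IHu|t IHt].
- by rewrite (alg_hom_map f r) (alg_hom_map g r).
- exact: e.
- by rewrite pclassD !hom_add IHt IHu.
- by rewrite pclassM !hom_mul IHt IHu.
- by rewrite pclassN !hom_opp IHt.
Qed.

(** The two homomorphisms are the evaluations at [x] and at [x + d]; the formula
    holds to first order modulo any ideal containing the products [d_i d_j].
    The only second order term, the product of the two differentials, arises in
    the case of a product. *)
Lemma taylor (K : B -> Prop) (idK : is_ideal K) n
    (f g : alg_hom (poly_alg R n) B)
    (d := fun i => (g (pvar R i) - f (pvar R i))%cr) :
  (forall i j, K (d i * d j)%cr) ->
  forall p, K (g p - (f p + csum (fun j => f (pderiv j p) * d j)))%cr.
Proof.
move=> hd p; case: (qcl_surj p) => t ->; rewrite -[qcl _ _]/(pclass t).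
pose D t := csum (fun j => f (pterm_deriv j t) * d j)%cr.
have -> : csum (fun j => f (pderiv j (pclass t)) * d j)%cr = D t.
  by apply: eq_csum => j; rewrite /pderiv /pclass qlift_cl.
have DD u v : K (D u * D v)%cr.
  rewrite /D csum_mul; apply: (ideal_sum idK) => j.
  have -> a b : (a * b = b * a :> B)%cr by ring.
  rewrite csum_mul; apply: (ideal_sum idK) => i.
  have -> : (f (pterm_deriv j v) * d j * (f (pterm_deriv i u) * d i) =
    f (pterm_deriv j v) * f (pterm_deriv i u) * (d j * d i))%cr by ring.
  exact: (idealM idK).
elim: t => [r|i|t IHt u IHu|t IHt u IHu|t IHt].
- rewrite (alg_hom_map f r) (alg_hom_map g r).
  have -> : D (PConst r) = 0%cr.
    rewrite -(csum0 B n); apply: eq_csum => j /=; rewrite hom_0; ring.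
  match goal with |- K ?a => have -> : a = 0%cr by ring end.
  exact: (ideal0 idK).
- have -> : D (PVar i) = d i.
    rewrite -[RHS]csum_delta; apply: eq_csum => j /=.
    by case: eqP => _; rewrite ?hom_0 ?hom_1.
  rewrite -[pclass _]/(pvar R i).
  match goal with |- K ?a => have -> : a = 0%cr by rewrite /d; ring end.
  exact: (ideal0 idK).
- have -> : D (PAdd t u) = (D t + D u)%cr.
    by rewrite csum_add; apply: eq_csum => j /=; rewrite hom_add; ring.
  rewrite pclassD !hom_add.
  move: (idealD idK IHt IHu); congr (K _); ring.
- have -> : D (PMul t u) = (f (pclass u) * D t + f (pclass t) * D u)%cr.
    rewrite !csum_mul csum_add; apply: eq_csum => j /=.
    by rewrite hom_add !hom_mul; ring.
  rewrite pclassM !hom_mul.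
  move: (idealD idK (idealD idK (idealM idK (g (pclass u)) IHt)
    (idealM idK (f (pclass t) + D t)%cr IHu)) (DD t u)).
  congr (K _); ring.
- have -> : D (POpp t) = (- D t)%cr.
    by rewrite csum_opp; apply: eq_csum => j /=; rewrite hom_opp; ring.
  rewrite pclassN !hom_opp.
  move: (ideal_opp idK IHt); congr (K _); ring.
Qed.

(** A homomorphism from the quotient, seen as a common root of the [P_i]. *)
Definition quot_point n l (P : 'I_l -> poly_alg R n) (h : alg_hom (poly_quot P) B)
    : alg_hom (poly_alg R n) B :=
  @AlgHom R (poly_alg R n) B (comp_hom h (ideal_proj P)) (alg_hom_map h).

Lemma quot_point_root n l (P : 'I_l -> poly_alg R n) h i :
  quot_point (P := P) h (P i) = 0%cr.
Proof.
rewrite -(hom_0 h) /=; congr (h _); apply: (qcl_eq (eq_mod_equiv P)).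
exists (fun j => if i == j then 1 else 0)%cr.
by rewrite csum_delta csub0.
Qed.

(** With [quot_hom_eq] and [quot_point_root]: homomorphisms out of the quotient
    are the common roots of the [P_i]. *)
Lemma quot_hom_exists n l (P : 'I_l -> poly_alg R n)
    (f : alg_hom (poly_alg R n) B) :
  (forall i, f (P i) = 0%cr) ->
  exists h : alg_hom (poly_quot P) B, forall p, quot_point h p = f p.
Proof.
move=> fP.
have fE p q : eq_mod P p q -> f p = f q.
  move=> [c e]; apply: csub_eq0; rewrite -hom_opp -hom_add e hom_csum.
  by rewrite -(csum0 B l); apply: eq_csum => i; rewrite hom_mul fP; ring.
have [g hg] := quot_rec trunc_elim (eq_mod_equiv P) fE.
have surj (a : ideal_quot P) : exists p, a = ideal_proj P p.
  by case: (qcl_surj a) => p ->; exists p.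
have gp p : g (ideal_proj P p) = f p by apply: hg.
have g1 : g (1%cr : ideal_quot P) = 1%cr by rewrite -(hom_1 f) -gp.
have gD (a b : ideal_quot P) : g (a + b)%cr = (g a + g b)%cr.
  by case: (surj a) (surj b) => [p ->] [q ->]; rewrite -hom_add !gp hom_add.
have gM (a b : ideal_quot P) : g (a * b)%cr = (g a * g b)%cr.
  by case: (surj a) (surj b) => [p ->] [q ->]; rewrite -hom_mul !gp hom_mul.
unshelve eexists (@AlgHom R (poly_quot P) B (@RingHom (poly_quot P) B g g1 gD gM) _).
  by move=> r; rewrite -(alg_hom_map f r) -gp.
exact: gp.
Qed.

Lemma quot_hom_eq n l (P : 'I_l -> poly_alg R n) (h h' : alg_hom (poly_quot P) B) :
  (forall i, quot_point h (pvar R i) = quot_point h' (pvar R i)) -> h = h'.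
Proof.
move=> e; apply: alg_hom_eq => a; case: (qcl_surj a) => p ->.
exact: (poly_hom_eq e p).
Qed.

End Points.

(** * Lifting roots along a nilpotent ideal *)

Section InfinitesimalLifting.
Context (trunc_elim : prop_trunc_elim) (R : cring) (B : alg R).
Context (k : nat) (r : 'I_k -> B) (N : nat).
Context (powN : forall a, ideal_pow r N a -> a = 0%cr).
Context (n : nat) (P : 'I_n -> poly_alg R n).
Context (unitP : invertible (ideal_proj P (det (jacobian P)))).
Add Ring Bring' : (cring_th B).

(** An inverse [q] of the determinant modulo the [P_i] is, at an approximate
    root, an inverse modulo [I], which is nilpotent. *)
Lemma jacobian_unit (f : alg_hom (poly_alg R n) B) :
  (forall i, ideal_pow r 1 (f (P i))) ->
  invertible (det (fun i j => f (jacobian P i j))).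
Proof.
move=> fP; rewrite -hom_det; case: unitP => y; case: (qcl_surj y) => q -> e.
have [c hc] : eq_mod P (det (jacobian P) * q)%cr 1%cr.
  by apply: (qcl_inj (eq_mod_equiv P)); apply: etrans e; symmetry; apply: qmul_cl.
have h1 : ideal_pow r 1 (f (det (jacobian P)) * f q - 1)%cr.
  rewrite -(hom_1 f) -hom_mul -hom_opp -hom_add hc hom_csum.
  apply: (ideal_sum (ideal_pow_ideal r 1)) => i; rewrite hom_mul.
  exact: (idealM (ideal_pow_ideal r 1)).
have [z /powN hz] := ideal_pow_unit N h1.
by exists z; apply: csub_eq0.
Qed.

(** The correction [w] solves [J w = - P] at the current point, so the linear
    term of Taylor's formula cancels [P]; the remainder is made of products of
    an element of [I] and one of [I^(m+1)]. *)
Lemma newton_step m (f : alg_hom (poly_alg R n) B) :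
  (forall i, ideal_pow r m.+1 (f (P i))) ->
  exists g : alg_hom (poly_alg R n) B,
    (forall i, ideal_pow r m.+2 (g (P i))) /\
    forall j, ideal_pow r 1 (g (pvar R j) - f (pvar R j))%cr.
Proof.
move=> fP; have fP1 i := ideal_pow_sub1 (fP i).
have [w [hw ew]] := solve_in_ideal (ideal_pow_ideal r m.+1) (jacobian_unit fP1)
  (fun i => ideal_opp (ideal_pow_ideal r m.+1) (fP i)).
have [g hg] := poly_hom_exists trunc_elim (fun j => f (pvar R j) + w j)%cr.
have ed j : (g (pvar R j) - f (pvar R j) = w j)%cr by rewrite hg; ring.
exists g; split=> [i|j]; last by rewrite ed; apply: ideal_pow_sub1 (hw j).
have hd i' j' : ideal_pow r m.+2
    ((g (pvar R i') - f (pvar R i')) * (g (pvar R j') - f (pvar R j')))%cr.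
  rewrite !ed; apply: ideal_pow_mul; last exact: hw.
  exact: ideal_pow_sub1 (hw i').
move: (taylor (ideal_pow_ideal r m.+2) hd (P i)).
have -> : csum (fun j => f (pderiv j (P i)) * (g (pvar R j) - f (pvar R j)))%cr
          = (- f (P i))%cr.
  by rewrite -ew; apply: eq_csum => j; rewrite ed.
by congr (ideal_pow _ _ _); ring.
Qed.

Lemma newton m (f : alg_hom (poly_alg R n) B) :
  (forall i, ideal_pow r 1 (f (P i))) ->
  exists g : alg_hom (poly_alg R n) B,
    (forall i, ideal_pow r m.+1 (g (P i))) /\
    forall j, ideal_pow r 1 (g (pvar R j) - f (pvar R j))%cr.
Proof.
move=> fP; elim: m => [|m [g [gP gf]]].
  exists f; split=> // j; have -> a : (a - a = 0 :> B)%cr by ring.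
  exact: (ideal0 (ideal_pow_ideal r 1)).
have [g' [g'P g'g]] := newton_step gP; exists g'; split=> // j.
have -> : (g' (pvar R j) - f (pvar R j) = (g' (pvar R j) - g (pvar R j)) +
  (g (pvar R j) - f (pvar R j)))%cr by ring.
exact: (idealD (ideal_pow_ideal r 1)).
Qed.

(** The Newton iteration stops at a true root once the power of the ideal
    vanishes. *)
Lemma root_lift_exists (f : alg_hom (poly_alg R n) B) :
  (forall i, ideal_pow r 1 (f (P i))) ->
  exists h : alg_hom (poly_quot P) B,
    forall j, ideal_pow r 1 (quot_point h (pvar R j) - f (pvar R j))%cr.
Proof.
move=> /(newton N) [g [gP gf]].
have [i|h hg] := quot_hom_exists trunc_elim (P := P) (f := g).
  by apply: powN; apply: ideal_pow_succ.
by exists h => j; rewrite hg.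
Qed.

(** At two roots the values of the [P_i] agree, so Taylor's formula says that
    [J d] is of second order in their difference [d]; since [J] is invertible,
    [d] in [I^(m+1)] implies [d] in [I^(m+2)]. *)
Lemma root_lift_unique (h h' : alg_hom (poly_quot P) B) :
  (forall j, ideal_pow r 1
     (quot_point h' (pvar R j) - quot_point h (pvar R j))%cr) ->
  h = h'.
Proof.
set f := quot_point h; set g := quot_point h'.
pose d j := (g (pvar R j) - f (pvar R j))%cr => d1.
have unitf : invertible (det (fun i j => f (jacobian P i j))).
  by apply: jacobian_unit => i; rewrite quot_point_root;
    apply: (ideal0 (ideal_pow_ideal r 1)).
have dm m : forall j, ideal_pow r m.+1 (d j).
  elim: m => [|m IH]; first exact: d1.
  apply: (cancel_in_ideal (ideal_pow_ideal r m.+2) unitf) => i.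
  have hd i' j' : ideal_pow r m.+2 (d i' * d j')%cr.
    by apply: ideal_pow_mul; [exact: d1|exact: IH].
  move: (taylor (ideal_pow_ideal r m.+2) hd (P i)).
  rewrite !quot_point_root => /(ideal_opp (ideal_pow_ideal r m.+2)).
  by congr (ideal_pow _ _ _); rewrite /d /jacobian; ring.
apply: quot_hom_eq => i; symmetry; apply: csub_eq0; apply: powN.
exact: (ideal_pow_succ (dm N i)).
Qed.

End InfinitesimalLifting.

(** * Closed propositions and duality *)

Lemma poly_quot_finitely_presented (R : cring) n l (P : 'I_l -> poly_alg R n) :
  finitely_presented (poly_quot P).
Proof.
exists n, l, P.
pose i := @AlgHom R (poly_quot P) (poly_quot P) (id_hom _) (fun _ => erefl _).
by exists i, i.
Qed.

Section ClosedPropositions.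
Context (trunc_elim : prop_trunc_elim) (R : cring) (dualR : duality R).
Context (k : nat) (r : 'I_k -> R).

(** The relations [r_i] on the polynomials in no variable present [R / (r)]. *)
Let Q (i : 'I_k) : poly_alg R 0 := alg_map (poly_alg R 0) (r i).

Lemma poly0_const (p : poly_alg R 0) : exists a, p = alg_map (poly_alg R 0) a.
Proof.
case: (qcl_surj p) => t ->; rewrite -[qcl _ _]/(pclass t).
elim: t => [a|[]//|t [a IHt] u [b IHu]|t [a IHt] u [b IHu]|t [a IHt]].
- by exists a.
- by exists (a + b)%cr; rewrite pclassD IHt IHu hom_add.
- by exists (a * b)%cr; rewrite pclassM IHt IHu hom_mul.
- by exists (- a)%cr; rewrite pclassN IHt hom_opp.
Qed.

Lemma quotient_const (a : poly_quot Q) : exists b, a = alg_map (poly_quot Q) b.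
Proof. by case: (qcl_surj a) => p ->; case: (poly0_const p) => b ->; exists b. Qed.

(** With [point_of_closed]: the closed proposition is the spectrum of
    [R / (r)]. *)
Lemma closed_of_point (x : Spec (poly_quot Q)) i : r i = 0%cr.
Proof.
rewrite -(quot_point_root x i); symmetry.
exact: (alg_hom_map (quot_point x) (r i)).
Qed.

Lemma point_of_closed : (forall i, r i = 0%cr) -> exists x : Spec (poly_quot Q), True.
Proof.
move=> r0; have [f _] := poly_hom_exists (B := base_alg R) trunc_elim
  (fun i : 'I_0 => 0%cr).
have [i|h _] := quot_hom_exists trunc_elim (P := Q) (f := f); last by exists h.
by rewrite (alg_hom_map f (r i)); apply: r0.
Qed.

(** The surjective half of duality: [f] is a function on [Spec (R / (r))], so it
    is given by an element of [R / (r)], of which [a] is a representative. *)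
Lemma closed_fun_constant (f : (forall i, r i = 0%cr) -> R) :
  exists a, forall p, f p = a.
Proof.
have [g [_ gK]] := dualR (poly_quot_finitely_presented Q).
pose F : fun_alg R (Spec (poly_quot Q)) := fun x => f (closed_of_point x).
have [a ea] := quotient_const (g F); exists a => p.
have [x _] := point_of_closed p.
have : ev_hom (poly_quot Q) (g F) x = F x by rewrite gK.
rewrite ea /F (prop_irrel (closed_of_point x) p) => <-.
exact: (alg_hom_map x a).
Qed.

(** The injective half of duality: [a] is 0 as a function on [Spec (R / (r))],
    so its class in [R / (r)] is 0. *)
Lemma closed_zero_in_ideal (a : R) :
  ((forall i, r i = 0%cr) -> a = 0%cr) -> in_ideal r a.
Proof.
move=> ha; have [g [Kg _]] := dualR (poly_quot_finitely_presented Q).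
have /(qcl_inj (eq_mod_equiv Q)) [c e] : alg_map (poly_quot Q) a = 0%cr.
  rewrite -(Kg (alg_map _ a)) -(hom_0 g); congr (g _).
  apply: functional_extensionality => x; rewrite /= (alg_hom_map x a).
  by apply: ha; apply: closed_of_point.
have [f _] := poly_hom_exists (B := base_alg R) trunc_elim (fun i : 'I_0 => 0%cr).
(* The [c i] are polynomials in no variable, evaluated in [R] by [f]. *)
exists (fun i => f (c i)).
transitivity (f (alg_map (poly_alg R 0) a)).
  by symmetry; apply: (alg_hom_map f).
have := congr1 f e; rewrite csub0 => ->; rewrite hom_csum; apply: eq_csum => i.
by rewrite hom_mul (alg_hom_map f (r i)).
Qed.

End ClosedPropositions.

(** * Standard etale schemes *)

Lemma poly_quot_formally_etale (trunc_elim : prop_trunc_elim) (R : cring)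
    (dualR : duality R) n (P : 'I_n -> poly_alg R n) :
  invertible (ideal_proj P (det (jacobian P))) ->
  formally_etale R (Spec (poly_quot P)).
Proof.
move=> unitP C [k [r [nilr eC]]]; have {C eC}-> : C = (forall i, r i = 0%cr).
  exact: propositional_extensionality.
have [N powN] := ideal_pow_nilpotent nilr.
have I1_of (a : base_alg R) : ((forall i, r i = 0%cr) -> a = 0%cr) ->
    ideal_pow (r : 'I_k -> base_alg R) 1 a.
  by move=> /(closed_zero_in_ideal trunc_elim dualR); apply: in_ideal_pow1.
have uniq (x y : Spec (poly_quot P)) : ((forall i, r i = 0%cr) -> x = y) -> x = y.
  move=> e; apply: (root_lift_unique (B := base_alg R) powN unitP) => j.
  apply: I1_of => /e ->; exact: (Ropp_def (cring_th R)).
suff ex : forall h : (forall i, r i = 0%cr) -> Spec (poly_quot P),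
    exists x, forall p, x = h p.
  have [h x y hx hy|g hg] := unique_choice trunc_elim ex.
    by apply: uniq => p; rewrite hx hy.
  exists g; split=> [x|h]; first by apply: uniq => p; apply: hg.
  by apply: functional_extensionality => p; apply: hg.
(* The coordinates of the partial point [h] extend to elements [x] of [R]. *)
move=> h; have /fin_choice [x hx] :
  forall j, exists a, forall p, quot_point (h p) (pvar R j) = a.
  by move=> j; apply: (closed_fun_constant trunc_elim dualR).
have [f hf] := poly_hom_exists (B := base_alg R) trunc_elim x.
have fh p q : f q = quot_point (h p) q.
  by apply: poly_hom_eq => j; rewrite hf hx.
have [i|x0 hx0] := root_lift_exists (B := base_alg R) trunc_elim powN unitP (f := f).
  by apply: I1_of => p; rewrite (fh p) quot_point_root.
exists x0 => p; apply: quot_hom_eq => j; rewrite -(fh p).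
exact: (csub_eq0 (ideal_pow1_zero p (hx0 j))).
Qed.

Lemma formally_etale_equiv (R : cring) (X Y : Type) :
  type_equiv X Y -> formally_etale R Y -> formally_etale R X.
Proof.
move=> [f [g [fK gK]]] etY C /etY [s [sK Ks]].
exists (fun h => g (s (fun p => f (h p)))); split=> [x|h].
  by rewrite sK.
apply: functional_extensionality => p.
have := congr1 (fun h' => h' p) (Ks (fun p => f (h p))) => /= ->.
exact: fK.
Qed.

(** The one-element cover by the whole type, which is open since the
    proposition [True] is [1 <> 0]. *)
Lemma affine_is_scheme (R : cring) (X : Type) :
  local_ring R -> affine_scheme R X -> scheme R X.
Proof.
move=> [one_neq0 _] [A [fpA [f [g [fK gK]]]]]; exists 1, (fun _ _ => True).
split=> [_ _|_|x]; last by exists ord0.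
  by exists 1, (fun _ => 1%cr); split=> // _; exists ord0.
exists A; split=> //; exists (fun x => f (proj1_sig x)).
exists (fun y => exist _ (g y) Logic.I); split=> [[x []] /=|y /=]; last exact: gK.
by rewrite fK.
Qed.

Theorem lemma4p3p3 (trunc_elim : prop_trunc_elim)
  (R : cring) (locR : local_ring R) (dualR : duality R)
  (zlcR : zariski_local_choice R)
  (X : Type) (stdX : standard_etale_scheme R X) : etale_scheme R X.
Proof.
case: stdX => n [P [unitP eX]]; split.
  apply: affine_is_scheme => //; exists (poly_quot P).
  by split=> //; apply: poly_quot_finitely_presented.
exact: (formally_etale_equiv eX (poly_quot_formally_etale trunc_elim dualR unitP)).
Qed.
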